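(* Let $G$ be a countably infinite group with identity $e$ and let $A\subseteq G$ satisfy $A=A^{-1}$ and $e\in A$. Then there exists $X\subseteq G$ such that $\Delta(X)=A$ and $|X\cap g_1X\cap g_2X|<\infty$ for all distinct $g_1,g_2\in G\setminus\{e\}$.
   Context: For $X\subseteq G$, $\Delta(X)=\{g\in G:|gX\cap X|=\infty\}$. *)

(* Defs.v *)
From HB Require Import structures.
From mathcomp Require Import all_boot.
From mathcomp Require Import boolp classical_sets functions cardinality.

Set Implicit Arguments.
Unset Strict Implicit.
Unset Printing Implicit Defensive.

Local Open Scope classical_set_scope.
Local Open Scope group_scope.

Section Translates.
Variable G : groupType.
Implicit Types (g : G) (X : set G).

Definition ltranslate g X : set G := [set g * x | x in X].

Definition Delta X : set G := [set g | infinite_set (ltranslate g X `&` X)].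

Definition inv_set X : set G := [set x^-1 | x in X].

End Translates.

(* Main.v *)
(* Enumerate A as (a_n) with every element repeated infinitely often, and take
   X to be the union of the blocks {x_n, a_n x_n}, where x_n is chosen so far
   out that a given g moves no point of a late block into another block.  Then
   g X and X meet, up to finitely many points, only within single blocks, so
   only for g in {1, a_n, a_n^-1}; and X, g1 X, g2 X cannot have a common point
   far out, since this would give three distinct points in a block of size 2. *)
Require Import Defs.
From HB Require Import structures.
From mathcomp Require Import all_boot.
From mathcomp Require Import boolp classical_sets functions cardinality.

Set Implicit Arguments.
Unset Strict Implicit.
Unset Printing Implicit Defensive.

Local Open Scope classical_set_scope.
Local Open Scope group_scope.

Lemma prefix_dependent_choice (T : Type) (P : seq T -> T -> Prop) :
  (forall s, exists x, P s x) -> exists x : nat -> T, forall n, P (mkseq x n) (x n).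
Proof.
move=> /choice[h Ph].
pose s n := iter n (fun s => rcons s (h s)) [::].
exists (h \o s) => n; suff -> : mkseq (h \o s) n = s n by exact: Ph.
by elim: n => // n IHn; rewrite mkseqS IHn.
Qed.

Lemma infinite_set_injective (T : Type) (S : set T) (h : nat -> T) :
  injective h -> (forall n, S (h n)) -> infinite_set S.
Proof.
move=> h_inj hS finS; apply: infinite_nat.
apply: (@sub_finite_set _ _ (h @^-1` S)); first by move=> n _; exact: hS.
by apply: finite_preimage => // i j _ _; exact: h_inj.
Qed.

(** The index [n] decodes to a pair of naturals: the first selects an element of [A], the second is
    ignored and so repeats that element infinitely often. *)
Lemma infinite_recurrent_enumeration (T : Type) (A : set T) :
  countable A -> A !=set0 ->
  exists2 a : nat -> T, (forall n, A (a n)) &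
    forall t, A t -> exists2 k : nat -> nat, injective k & forall j, a (k j) = t.
Proof.
move=> /countable_injP[f f_inj] [t0 At0].
have /choice[e eP] i : exists t, A t /\ forall t', A t' -> f t' = i -> t = t'.
  have [[t [At fti]]|nex] := pselect (exists t, A t /\ f t = i).
    exists t; split=> // t' At' ft'i; apply: f_inj; rewrite ?inE //.
    by rewrite fti ft'i.
  by exists t0; split=> // t' At' ft'i; case: nex; exists t'.
exists (fun n => e (odflt (0, 0)%N (unpickle n)).1) => [n|t At].
  by case: (eP (odflt (0, 0)%N (unpickle n)).1).
exists (fun j => pickle (f t, j)) => [i j /(pcan_inj pickleK)[]//|j].
by rewrite pickleK /=; case: (eP (f t)) => _; apply.
Qed.

(** The weight replaces a length function with finite balls. The minimum over [g] and its inverse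
    makes an injection [f] into [nat] symmetric; the truncated subtraction of [f 1] gives weight 0
    to the identity and only shifts the radius of a ball. *)
Lemma countable_group_weight (G : groupType) : countable [set: G] ->
  exists w : G -> nat, [/\ forall n, finite_set [set g | w g <= n]%N,
    forall g, w g^-1 = w g & w 1 = 0%N].
Proof.
move=> /countable_injP[f f_inj].
have inj_f : injective f by move=> g h; apply: f_inj; rewrite inE.
exists (fun g => minn (f g) (f g^-1) - f 1%g)%N; split=> [n|g|].
- have finf : finite_set (f @^-1` `I_(n + f 1%g).+1).
    by apply: finite_preimage => [g h _ _|]; [exact: inj_f|exact: finite_II].
  apply: (@sub_finite_set _ _
    (f @^-1` `I_(n + f 1%g).+1 `|` (fun g => g^-1) @^-1` (f @^-1` `I_(n + f 1%g).+1))).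
    by move=> g /=; rewrite leq_subLR geq_min addnC => /orP[]; [left|right].
  rewrite finite_setU; split=> //.
  by apply: finite_preimage => // g h _ _; exact: invg_inj.
- by rewrite invgK minnC.
- by rewrite invg1 minnn subnn.
Qed.

Definition block_point (G : groupType) (a x : G) (b : bool) : G :=
  if b then a * x else x.

Lemma block_pointE (G : groupType) (a x : G) b :
  block_point a x b = block_point a 1 b * x.
Proof. by case: b; rewrite /block_point ?mulg1 ?mul1g. Qed.

(** At stage [n], each earlier point [u] and each choice of [c] exclude only finitely many
    candidates [y]: multiplication is injective and balls of [w] are finite. An infinite group has a
    candidate left. *)
Lemma sparse_blocks (G : groupType) (w : G -> nat) (a : nat -> G) :
  infinite_set [set: G] -> (forall n, finite_set [set g | w g <= n]%N) ->
  exists x : nat -> G, forall m n b c, (m < n)%N ->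
    (n < w (block_point (a n) (x n) c * (block_point (a m) (x m) b)^-1)%g)%N.
Proof.
move=> G_infinite w_fin.
pose P (s : seq G) y := forall m b c, (m < size s)%N ->
  (size s < w (block_point (a (size s)) y c *
               (block_point (a m) (nth 1 s m) b)^-1)%g)%N.
have [s|x xP] := @prefix_dependent_choice G P; last first.
  exists x => m n b c mn; have := xP n m b c.
  by rewrite /P size_mkseq nth_mkseq //; apply.
pose bad (t : 'I_(size s) * bool * bool) := [set y |
  w (block_point (a (size s)) y t.2 *
     (block_point (a t.1.1) (nth 1 s t.1.1) t.1.2)^-1)%g <= size s]%N.
have bad_fin : finite_set (\bigcup_t bad t).
  apply: bigcup_finite => [|t _]; first exact: finite_finset.
  rewrite /bad; move: (block_point _ _ t.1.2) => u.
  apply: (@finite_preimage _ _ [set g | w g <= size s]%N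
    (fun y => block_point (a (size s)) y t.2 * u^-1)) => //.
  move=> y z _ _ /mulIg; rewrite [LHS]block_pointE [RHS]block_pointE.
  exact: mulgI.
have [y ngood] : exists y, ~ (\bigcup_t bad t) y.
  apply/existsNP => all_bad; apply: G_infinite.
  by apply: sub_finite_set bad_fin => y _; exact: all_bad.
exists y => m b c ms; rewrite ltnNge; apply/negP => le.
by apply: ngood; exists (Ordinal ms, b, c).
Qed.

Theorem theorem5p3 (G : groupType)
    (G_countable : countable [set: G]) (G_infinite : infinite_set [set: G])
    (A : set G) (A_sym : A = inv_set A) (A_e : A 1) :
  exists X : set G,
    Delta X = A /\
    (forall g1 g2 : G, g1 <> 1 -> g2 <> 1 -> g1 <> g2 ->
       finite_set (X `&` ltranslate g1 X `&` ltranslate g2 X)).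
Proof.
have A_inv g : A g -> A g^-1 by move=> Ag; rewrite A_sym; exists g.
have [w [w_fin wV w1]] := countable_group_weight G_countable.
have [||a aA a_rec] := @infinite_recurrent_enumeration _ A.
- by apply: sub_countable G_countable; exact: subset_card_le.
- by exists 1.
have [x x_sparse] := @sparse_blocks _ w a G_infinite w_fin.
pose q n b := block_point (a n) (x n) b.
(* For [m < n] the sparseness bounds the weight of [g] itself from below, for [n < m] that of its
   inverse; [wV] makes both contradict the upper bound. *)
have same_block g m n b c : (w g <= maxn m n)%N -> g * q m b = q n c -> m = n.
  move=> wg E; have Eg : g = q n c * (q m b)^-1 by rewrite -E mulgK.
  case: (ltngtP m n) => // lt_mn; move: wg.
    by rewrite (maxn_idPr (ltnW lt_mn)) Eg leqNgt x_sparse.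
  rewrite (maxn_idPl (ltnW lt_mn)) -wV Eg invgM invgK.
  by rewrite leqNgt x_sparse.
pose X := [set q p.1 p.2 | p in [set: nat * bool]].
have Xq n b : X (q n b) by exists (n, b).
(* Only finitely many points of [X] lie in blocks with index below [N]. *)
have late_point S N : infinite_set S -> S `<=` X ->
    exists n b, (N <= n)%N /\ S (q n b).
  move=> infS SX; apply: contrapT => early; apply: infS.
  apply: (@sub_finite_set _ _
    ((fun p : nat * bool => q p.1 p.2) @` (`I_N `*` [set: bool]))).
    move=> y Sy; have [[n b] _ /= E] := SX _ Sy; exists (n, b) => //.
    split=> //=; rewrite ltnNge; apply/negP => Nn; apply: early.
    by exists n, b; rewrite E.
  apply: finite_image; apply: finite_setX; first exact: finite_II.
  exact: finite_finset.
exists X; split.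
  apply/seteqP; split=> [g Xg|g Ag].
    have [|n [c [wn [[_ [[m b] _ <-] /= E] _]]]] := late_point _ (w g) Xg.
      by move=> y [].
    have mn : m = n by apply: (same_block g _ _ b c) => //; rewrite leq_max wn orbT.
    (* Inside one block, [g] either fixes a point, hence is 1, or moves one point to the other,
       hence is [a n] or its inverse. *)
    move: E; rewrite mn /q; case: b c {wn mn} => -[] /= E.
    + by have -> : g = 1 by apply: (mulIg (a n * x n)); rewrite mul1g.
    + have -> : g = (a n)^-1; last exact: A_inv.
      by apply: (mulIg (a n * x n)); rewrite mulKg.
    + by have -> : g = a n by exact: mulIg E.
    + by have -> : g = 1 by apply: (mulIg (x n)); rewrite mul1g.
  have [k k_inj ak] := a_rec g Ag.
  apply: (@infinite_set_injective _ _ (fun j => g * x (k j))) => [i j|j].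
    (* [same_block] for the identity, of weight 0, shows that [x] is injective. *)
    move=> /mulgI E; apply: k_inj; apply: (same_block 1 _ _ false false).
      by rewrite w1.
    by rewrite mul1g.
  split; first by exists (x (k j)) => //; exact: (Xq (k j) false).
  by have := Xq (k j) true; rewrite /q /= ak.
move=> g1 g2 g1n1 g2n1 g12; apply: contrapT => inf.
have [|n [b [wn [[_ [_ [[m1 b1] _ <-] /= E1]] [_ [[m2 b2] _ <-] /= E2]]]]] :=
    late_point _ (maxn (w g1) (w g2)) inf.
  by move=> y [[]].
move: wn; rewrite geq_max => /andP[wn1 wn2].
have e1 : m1 = n by apply: (same_block g1 _ _ b1 b) => //; rewrite leq_max wn1 orbT.
have e2 : m2 = n by apply: (same_block g2 _ _ b2 b) => //; rewrite leq_max wn2 orbT.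
subst m1 m2.
(* Two equal labels among [b], [b1], [b2] would force [g1 = 1], [g2 = 1] or [g1 = g2] by
   cancellation, but there are only two Booleans. *)
have b1b : b1 <> b.
  by move=> e; apply: g1n1; apply: (mulIg (q n b)); rewrite mul1g -{1}e.
have b2b : b2 <> b.
  by move=> e; apply: g2n1; apply: (mulIg (q n b)); rewrite mul1g -{1}e.
have b12 : b1 <> b2.
  by move=> e; apply: g12; apply: (mulIg (q n b1)); rewrite E1 e.
by case: b b1 b2 b1b b2b b12 {E1 E2} => -[] [].
Qed.
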